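(* Let $(W,S)$ be a Coxeter system with $S$ finite, and let $F:W\to\operatorname{Ad}(Q_W)$ be the map with $F(w)=e_{s_1}\cdots e_{s_k}$ whenever $w=s_1\cdots s_k$ ($s_i\in S$) is a reduced expression. Define $c:W\times W\to C_W$ by $c(w_1,w_2)=F(w_1)F(w_2)F(w_1w_2)^{-1}$. Then $c$ is a normalized $2$-cocycle (with values in the trivial $W$-module $C_W$), and its cohomology class $[c]\in H^2(W,C_W)$ equals the class $u_\phi$ of the central extension $1\to C_W\to\operatorname{Ad}(Q_W)\xrightarrow{\phi}W\to1$.
   Context: A Coxeter system $(W,S)$: $S$ finite, $m:S\times S\to\mathbb{N}\cup\{\infty\}$ with $m(s,s)=1$, $2\le m(s,t)=m(t,s)\le\infty$ for $s\ne t$, $W=\langle s\in S\mid (st)^{m(s,t)}=1\ (m(s,t)<\infty)\rangle$. The Coxeter quandle $Q_W=\bigcup_{w\in W}w^{-1}Sw$ has operation $x\ast y=yxy$; $\operatorname{Ad}(Q_W)=\langle e_x\ (x\in Q_W)\mid e_y^{-1}e_xe_y=e_{x\ast y}\rangle$; $\phi:\operatorname{Ad}(Q_W)\to W$ is $e_x\mapsto x$, and $C_W=\ker\phi$, which is a central subgroup. The map $F$ is well defined, i.e. the product $e_{s_1}\cdots e_{s_k}$ does not depend on the choice of reduced expression of $w$ (this follows from Matsumoto's theorem, since $(e_se_t)_{m(s,t)}=(e_te_s)_{m(s,t)}$ holds, where $(gh)_m$ denotes the alternating product $ghg\cdots$ with $m$ factors). The class $u_\phi$ is the element of $H^2(W,C_W)$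 classifying the central extension in the standard way. *)

(* Defs.v *)
(* MathComp (boot) world; groups given by presentations are modelled as
   setoids of words (free-group words modulo the congruence generated by
   free reduction and the relators). *)
From Stdlib Require Import ClassicalEpsilon.
From mathcomp Require Import all_boot.

Unset Strict Implicit.
Unset Printing Implicit Defensive.

(* A letter (x, false) stands for x, (x, true) for x^{-1}. *)
Definition word (X : Type) := seq (X * bool).

Definition letter_inv {X : Type} (a : X * bool) : X * bool := (a.1, ~~ a.2).

Definition winv {X : Type} (u : word X) : word X := rev (map letter_inv u).

Definition pos {X : Type} (l : seq X) : word X := map (fun x => (x, false)) l.

(* Equality in the group < X | r = 1 (R r) >: multiplication is
   concatenation, identity [::], inverse winv. *)
Inductive pres_eq {X : Type} (R : word X -> Prop) : word X -> word X -> Prop :=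
| pe_refl u : pres_eq R u u
| pe_sym u v : pres_eq R u v -> pres_eq R v u
| pe_trans u v w : pres_eq R u v -> pres_eq R v w -> pres_eq R u w
| pe_free u v a : pres_eq R (u ++ a :: letter_inv a :: v) (u ++ v)
| pe_rel u v r : R r -> pres_eq R (u ++ r ++ v) (u ++ v).

(* Coxeter matrix m : S -> S -> nat, where the value 0 encodes m(s,t) = oo. *)
Definition coxeter_matrix {S : finType} (m : S -> S -> nat) : Prop :=
  (forall s, m s s = 1) /\ (forall s t, m s t = m t s) /\
  (forall s t, s != t -> m s t != 1).

Fixpoint alt {S : Type} (s t : S) (n : nat) : seq S :=
  match n with 0 => [::] | n'.+1 => s :: alt t s n' end.

Definition cox_rel {S : finType} (m : S -> S -> nat) (r : word S) : Prop :=
  exists s t, 0 < m s t /\ r = pos (alt s t (2 * m s t)).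

Definition W_eq {S : finType} (m : S -> S -> nat) := pres_eq (cox_rel m).

Definition inQ {S : finType} (m : S -> S -> nat) (w : word S) : Prop :=
  exists (v : word S) (s : S), W_eq m w (winv v ++ (s, false) :: v).

Definition QW {S : finType} (m : S -> S -> nat) := {w : word S | inQ m w}.

(* relators of Ad(Q_W): e_x = e_x' when x = x' in W, and
   e_y^{-1} e_x e_y = e_{x * y} with x * y = y x y *)
Definition ad_rel {S : finType} (m : S -> S -> nat) (r : word (QW m)) : Prop :=
  (exists x x' : QW m, W_eq m (proj1_sig x) (proj1_sig x') /\
       r = [:: (x, false); (x', true)])
  \/ (exists x y z : QW m,
       W_eq m (proj1_sig z) (proj1_sig y ++ proj1_sig x ++ proj1_sig y) /\
       r = [:: (y, true); (x, false); (y, false); (z, true)]).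

Definition Ad_eq {S : finType} (m : S -> S -> nat) := pres_eq (ad_rel m).

Definition phi {S : finType} (m : S -> S -> nat) (a : word (QW m)) : word S :=
  flatten (map (fun l : QW m * bool =>
     if l.2 then winv (proj1_sig l.1) else proj1_sig l.1) a).

Definition inC {S : finType} (m : S -> S -> nat) (a : word (QW m)) : Prop :=
  W_eq m (phi m a) [::].

Definition gen_of {S : finType} (m : S -> S -> nat) (s : S) : QW m :=
  exist (inQ m) (pos [:: s])
    (ex_intro _ [::] (ex_intro _ s (pe_refl (cox_rel m) [:: (s, false)]))).

Definition reduced_expr {S : finType} (m : S -> S -> nat) (w : word S)
  (l : seq S) : Prop :=
  W_eq m (pos l) w /\ forall l', W_eq m (pos l') w -> size l <= size l'.

Definition red_of {S : finType} (m : S -> S -> nat) (w : word S) : seq S :=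
  epsilon (inhabits [::]) (reduced_expr m w).

Definition Fmap {S : finType} (m : S -> S -> nat) (w : word S) : word (QW m) :=
  pos (map (gen_of m) (red_of m w)).

Definition ccoc {S : finType} (m : S -> S -> nat) (w1 w2 : word S)
  : word (QW m) :=
  Fmap m w1 ++ Fmap m w2 ++ winv (Fmap m (w1 ++ w2)).

Definition is_section {S : finType} (m : S -> S -> nat)
  (sigma : word S -> word (QW m)) : Prop :=
  (forall w w', W_eq m w w' -> Ad_eq m (sigma w) (sigma w')) /\
  (forall w, W_eq m (phi m (sigma w)) w).

(* the 2-cocycle of the extension attached to a section: s(w1)s(w2)s(w1w2)^{-1};
   its class is u_phi *)
Definition ext_cocycle {S : finType} (m : S -> S -> nat)
  (sigma : word S -> word (QW m)) (w1 w2 : word S) : word (QW m) :=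
  sigma w1 ++ sigma w2 ++ winv (sigma (w1 ++ w2)).

(* c is a well-defined map W x W -> C_W which is a normalized 2-cocycle for
   the trivial action (written multiplicatively; C_W is abelian). *)
Definition normalized_2cocycle {S : finType} (m : S -> S -> nat)
  (c : word S -> word S -> word (QW m)) : Prop :=
  (forall w1 w1' w2 w2', W_eq m w1 w1' -> W_eq m w2 w2' ->
      Ad_eq m (c w1 w2) (c w1' w2')) /\
  (forall w1 w2, inC m (c w1 w2)) /\
  (forall w, Ad_eq m (c [::] w) [::] /\ Ad_eq m (c w [::]) [::]) /\
  (forall g h k, Ad_eq m (c h k ++ c g (h ++ k)) (c (g ++ h) k ++ c g h)).

(* c and c' differ by the coboundary of some b : W -> C_W
   (trivial action: (db)(w1,w2) = b(w1) b(w2) b(w1 w2)^{-1}) *)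
Definition cohomologous {S : finType} (m : S -> S -> nat)
  (c c' : word S -> word S -> word (QW m)) : Prop :=
  exists b : word S -> word (QW m),
    (forall w w', W_eq m w w' -> Ad_eq m (b w) (b w')) /\
    (forall w, inC m (b w)) /\
    (forall w1 w2, Ad_eq m (c w1 w2)
                     (c' w1 w2 ++ b w1 ++ b w2 ++ winv (b (w1 ++ w2)))).

(* Main.v *)
(* Tits' reflection count shows that the parity of
   the number of prefixes conjugating a letter of a word to a given x is an
   invariant of the element of W it represents; for reduced words this gives
   the strong exchange condition: if x l and l' are reduced words of the same
   element, then l' = P y Q with P y P^-1 = x in W.  In Ad(Q_W) the quandle
   relations turn this into e_P e_y = e_x e_P, and induction on the length
   gives F(x l) = F(l').  Conjugation by a in Ad(Q_W) acts on generators
   through phi(a), so ker phi = C_W is central.  Since phi (F w) = w, c takes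
   values in C_W, centrality yields the cocycle identity, and for a section
   sigma of phi the cochain b(w) = F(w) sigma(w)^-1 is C_W-valued with
   c = c_sigma * db. *)
Require Import Defs.
From mathcomp Require Import all_boot.
From Stdlib Require Import Setoid Morphisms ClassicalEpsilon Classical.

Lemma pres_eq_cat X (R : word X -> Prop) u v p q :
  pres_eq R u v -> pres_eq R (p ++ u ++ q) (p ++ v ++ q).
Proof.
elim=> {u v}.
- by move=> u; apply: pe_refl.
- by move=> u v _; apply: pe_sym.
- by move=> u v w _ H1 _; apply: pe_trans.
- by move=> u v a; have := pe_free R (p ++ u) (v ++ q) a; rewrite -!catA.
- by move=> u v r Rr; have := pe_rel R (p ++ u) (v ++ q) r Rr; rewrite -!catA.
Qed.
Arguments pres_eq_cat {X R u v} p q.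

#[global] Instance pres_eq_equiv X (R : word X -> Prop) :
  Equivalence (pres_eq R).
Proof. by split; [exact: pe_refl | exact: pe_sym | exact: pe_trans]. Qed.

#[global] Instance cat_pres_eq X (R : word X -> Prop) :
  Proper (pres_eq R ==> pres_eq R ==> pres_eq R) (@cat (X * bool)).
Proof.
move=> u u' Eu v v' Ev; transitivity (u' ++ v).
  by have := pres_eq_cat [::] v Eu.
by have := pres_eq_cat u' [::] Ev; rewrite !cats0.
Qed.

#[global] Instance cons_pres_eq X (R : word X -> Prop) a :
  Proper (pres_eq R ==> pres_eq R) (cons a).
Proof. by move=> u v E; have := pres_eq_cat [:: a] [::] E; rewrite !cats0. Qed.

#[global] Hint Resolve pe_refl : core.

Section Presentation.
Variables (X : Type) (R : word X -> Prop).
Local Notation "u ~ v" := (pres_eq R u v) (at level 70).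

Lemma pres_eq_rel {r} : R r -> r ~ [::].
Proof. by move=> Rr; have := pe_rel R [::] [::] r Rr; rewrite /= cats0. Qed.

Lemma letter_invK : involutive (@letter_inv X).
Proof. by case=> x []. Qed.

Lemma pres_eq_rel_last u a : R (u ++ [:: letter_inv a]) -> u ~ [:: a].
Proof.
move=> Rr; transitivity ((u ++ [:: letter_inv a]) ++ [:: a]).
  have := pe_free R u [::] (letter_inv a); rewrite letter_invK cats0 => E.
  by rewrite -catA; symmetry.
by rewrite (pres_eq_rel Rr).
Qed.

Lemma winv_cat (u v : word X) : winv (u ++ v) = winv v ++ winv u.
Proof. by rewrite /winv map_cat rev_cat. Qed.

Lemma winv_cons a (u : word X) : winv (a :: u) = winv u ++ [:: letter_inv a].
Proof. by rewrite /winv /= rev_cons -cats1. Qed.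

Lemma winvK : involutive (@winv X).
Proof.
by move=> u; rewrite /winv map_rev revK -map_comp (eq_map letter_invK) map_id.
Qed.

Lemma catwV (u : word X) : u ++ winv u ~ [::].
Proof.
elim: u => [|a u IH] //=; rewrite winv_cons.
transitivity ([:: a] ++ [::] ++ [:: letter_inv a]).
  by have := pres_eq_cat [:: a] [:: letter_inv a] IH; rewrite /= -catA.
exact: (pe_free R [::] [::] a).
Qed.

Lemma catVw (u : word X) : winv u ++ u ~ [::].
Proof. by have := catwV (winv u); rewrite winvK. Qed.

Lemma catKVw (u q : word X) : u ++ winv u ++ q ~ q.
Proof. by rewrite catA catwV. Qed.

Lemma catKw (u q : word X) : winv u ++ u ++ q ~ q.
Proof. by rewrite catA catVw. Qed.

#[global] Instance winv_pres_eq : Proper (pres_eq R ==> pres_eq R) (@winv X).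
Proof. by move=> u v E; rewrite -[winv u]cats0 -(catwV v) -{1}E catA catVw. Qed.

Lemma pres_eq_catlI (p u v : word X) : p ++ u ~ p ++ v -> u ~ v.
Proof. by move=> E; rewrite -(catKw p u) E catKw. Qed.

Definition conjw (p r : word X) : word X := p ++ r ++ winv p.

Lemma conjw_eqE (p r x : word X) : conjw p r ~ x <-> r ~ winv p ++ x ++ p.
Proof.
rewrite /conjw; split=> [<-|->]; rewrite !catA.
  by rewrite catVw -catA catVw cats0.
by rewrite catwV -catA catwV cats0.
Qed.

Lemma conjw_cat (p r x q : word X) : conjw p r ~ x -> p ++ r ++ q ~ x ++ p ++ q.
Proof. by move=> <-; rewrite /conjw -!catA catKw. Qed.

Lemma commute_winv (u v : word X) :
  u ++ v ~ v ++ u -> u ++ winv v ~ winv v ++ u.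
Proof.
move=> E; transitivity (winv v ++ (v ++ u) ++ winv v).
  by rewrite -catA catKw.
by rewrite -E -catA catwV cats0.
Qed.

Definition central (c : word X) : Prop := forall a, c ++ a ~ a ++ c.

Lemma central_move {c : word X} :
  central c -> forall p q, p ++ c ++ q ~ c ++ p ++ q.
Proof. by move=> Cc p q; rewrite catA -Cc -catA. Qed.

Lemma cocycle_identity (fg fh fk fgh fhk fghk : word X) :
  central (fh ++ fk ++ winv fhk) -> central (fg ++ fh ++ winv fgh) ->
  (fh ++ fk ++ winv fhk) ++ (fg ++ fhk ++ winv fghk) ~
  (fgh ++ fk ++ winv fghk) ++ (fg ++ fh ++ winv fgh).
Proof.
move=> Chk Cgh; transitivity (fg ++ fh ++ fk ++ winv fghk).
  by rewrite -(central_move Chk fg) -!catA catKw.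
by rewrite -Cgh -!catA catKw.
Qed.

Lemma cocycle_coboundary (f1 f2 f12 s1 s2 s12 b1 b2 b12 : word X) :
  central b1 -> central b2 ->
  f1 ~ b1 ++ s1 -> f2 ~ b2 ++ s2 -> f12 ~ b12 ++ s12 ->
  f1 ++ f2 ++ winv f12 ~ (s1 ++ s2 ++ winv s12) ++ b1 ++ b2 ++ winv b12.
Proof.
move=> Cb1 Cb2 -> -> ->; set s := s1 ++ s2 ++ winv s12.
rewrite (central_move Cb1 s) (central_move Cb2 s) winv_cat -!catA.
by rewrite (central_move Cb2 s1).
Qed.

End Presentation.
Arguments conjw {X}.
Arguments central {X} R c.
Arguments pres_eq_catlI {X R} p {u v}.
Arguments conjw_cat {X R p r x} q.
Arguments commute_winv {X R u v}.
Arguments central_move {X R c}.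
Arguments cocycle_coboundary {X R f1 f2 f12 s1 s2 s12 b1 b2 b12}.

Lemma pos_cat X (l1 l2 : seq X) : pos (l1 ++ l2) = pos l1 ++ pos l2.
Proof. exact: map_cat. Qed.

Section Coxeter.
Variables (S : finType) (m : S -> S -> nat).
Hypothesis m_cox : coxeter_matrix m.
Local Notation "u ~ v" := (pres_eq (cox_rel m) u v) (at level 70).

Lemma W_relator (s t : S) : 0 < m s t -> pos (alt s t (m s t).*2) ~ [::].
Proof.
by move=> m_fin; apply: pres_eq_rel; exists s, t; rewrite mul2n.
Qed.

Lemma W_gen_sq s : [:: (s, false); (s, false)] ~ [::].
Proof.
have mss : m s s = 1 by case: m_cox.
by have := W_relator s s; rewrite mss; apply.
Qed.

Lemma W_letter s b : [:: (s, b)] ~ [:: (s, false)].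
Proof.
case: b => //; transitivity [:: (s, true); (s, false); (s, false)].
  symmetry; have := pres_eq_cat [:: (s, true)] [::] (W_gen_sq s).
  by rewrite cats0.
exact: (pe_free _ [::] [:: (s, false)] (s, true)).
Qed.

Lemma W_pos_fst (w : word S) : pos (map fst w) ~ w.
Proof.
elim: w => [|[s b] w IH] //=.
by rewrite -[_ :: pos _]cat1s -[(s, b) :: w]cat1s IH W_letter.
Qed.

Lemma W_QW_inv (x : QW m) : winv (proj1_sig x) ~ proj1_sig x.
Proof.
case: x => w [v [s E]] /=.
by rewrite E !winv_cat winvK winv_cons -catA W_letter.
Qed.

Definition W_eqb (u v : word S) : bool :=
  if excluded_middle_informative (u ~ v) then true else false.

Lemma W_eqbP u v : reflect (u ~ v) (W_eqb u v).
Proof. by rewrite /W_eqb; case: excluded_middle_informative; constructor. Qed.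

Lemma W_eqb_congr u u' v v' : u ~ u' -> v ~ v' -> W_eqb u v = W_eqb u' v'.
Proof.
by move=> Eu Ev; apply/W_eqbP/W_eqbP; [rewrite -Eu -Ev | rewrite Eu Ev].
Qed.

(* The i-th entry is u_1 ... u_{i-1} s_i (u_1 ... u_{i-1})^-1, where s_i is
   the generator of the i-th letter. *)
Fixpoint reflections (u : word S) : seq (word S) :=
  if u is a :: u' then [:: (a.1, false)] :: map (conjw [:: a]) (reflections u')
  else [::].

Definition refl_count (u x : word S) : nat := count (W_eqb^~ x) (reflections u).

Lemma reflections_cat u v :
  reflections (u ++ v) = reflections u ++ map (conjw u) (reflections v).
Proof.
elim: u => [|a u IH] /=.
  by rewrite -[LHS]map_id; apply: eq_map => r; rewrite /conjw cats0.
rewrite IH map_cat -map_comp; congr (_ :: (_ ++ _)); apply: eq_map => r.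
by rewrite /conjw /= !winv_cons -!catA.
Qed.

Lemma W_eqb_conjw p r x : W_eqb (conjw p r) x = W_eqb r (winv p ++ x ++ p).
Proof. by apply/W_eqbP/W_eqbP; rewrite conjw_eqE. Qed.

Lemma count_conjw p L x :
  count (W_eqb^~ x) (map (conjw p) L) = count (W_eqb^~ (winv p ++ x ++ p)) L.
Proof. by rewrite count_map; apply: eq_count => r; apply: W_eqb_conjw. Qed.

Lemma refl_count_insert p u q :
  u ~ [::] -> (forall x, ~~ odd (refl_count u x)) ->
  forall x, odd (refl_count (p ++ u ++ q) x) = odd (refl_count (p ++ q) x).
Proof.
move=> u1 u_even x; rewrite /refl_count !reflections_cat !map_cat !count_cat.
rewrite !count_conjw; set x' := winv p ++ x ++ p.
have -> : count (W_eqb^~ (winv u ++ x' ++ u)) (reflections q) =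
          count (W_eqb^~ x') (reflections q).
  by apply: eq_count => r /=; apply: W_eqb_congr; rewrite // u1 cats0.
by rewrite !oddD; move: (u_even x'); rewrite /refl_count; case: (odd _).
Qed.

Lemma alt_rcons (s t : S) n :
  alt s t n.+1 = rcons (alt s t n) (if odd n then t else s).
Proof.
elim: n s t => [|n IH] s t //.
by rewrite -[alt s t n.+2]/(s :: alt t s n.+1) IH /=; case: (odd n).
Qed.

Lemma alt_double_add (s t : S) k r :
  alt s t (k.*2 + r) = alt s t k.*2 ++ alt s t r.
Proof. by elim: k => [|k IH] //; rewrite doubleS !addSn /= IH. Qed.

Lemma pos_alt_odd_succ (s t : S) j :
  pos (alt s t j.+1.*2.+1) =
  (s, false) :: pos (alt t s j.*2.+1) ++ [:: (s, false)].
Proof.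
rewrite doubleS -[alt s t _]/(s :: alt t s j.*2.+2) alt_rcons /= odd_double.
by rewrite -cats1 pos_cat.
Qed.

Lemma count_reflections_alt k (s t : S) x :
  count (W_eqb^~ x) (reflections (pos (alt s t k))) =
  count (fun j => W_eqb (pos (alt s t j.*2.+1)) x) (iota 0 k).
Proof.
elim: k s t x => [|k IH] s t x //.
rewrite -[pos _]/((s, false) :: pos (alt t s k)) -[iota 0 _]/(0 :: iota 1 k).
rewrite [reflections _]/= -[_ :: map _ _]cat1s -[0 :: _]cat1s !count_cat.
rewrite count_conjw IH; congr (_ + _).
rewrite (iotaDl 1 0 k) count_map; apply: eq_count => j.
rewrite -[preim _ _ j]/(W_eqb (pos (alt s t j.+1.*2.+1)) x) pos_alt_odd_succ.
rewrite -W_eqb_conjw; apply: W_eqb_congr => //.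
by rewrite /conjw -[winv _]/[:: (s, true)] (W_letter s true).
Qed.

Lemma refl_count_relator_even (s t : S) :
  0 < m s t -> forall x, ~~ odd (refl_count (pos (alt s t (2 * m s t))) x).
Proof.
(* The reflections of (st)^m repeat with period m. *)
move=> m_fin x; rewrite /refl_count count_reflections_alt mul2n -addnn iotaD.
rewrite add0n -[in iota (m s t)](addn0 (m s t)) iotaDl count_cat count_map.
set F := fun j => _.
have -> : count (preim (addn (m s t)) F) (iota 0 (m s t)) =
          count F (iota 0 (m s t)).
  apply: eq_count => j; apply: W_eqb_congr => //.
  by rewrite doubleD -addnS alt_double_add pos_cat W_relator.
by rewrite addnn odd_double.
Qed.

Lemma refl_count_free_even a x : ~~ odd (refl_count [:: a; letter_inv a] x).
Proof.
rewrite /refl_count /= addn0.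
have -> : W_eqb (conjw [:: a] [:: ((letter_inv a).1, false)]) x =
          W_eqb [:: (a.1, false)] x.
  apply: W_eqb_congr => //; case: a => s b.
  rewrite -[conjw _ _]/([:: (s, b)] ++ [:: (s, false)] ++ [:: (s, ~~ b)]).
  rewrite (W_letter s b) (W_letter s (~~ b)).
  exact: (pres_eq_cat [::] [:: (s, false)] (W_gen_sq s)).
by rewrite addnn odd_double.
Qed.

Lemma refl_count_odd_W_eq {u v} :
  u ~ v -> forall x, odd (refl_count u x) = odd (refl_count v x).
Proof.
elim=> {u v}.
- by [].
- by move=> u v _ IH x; rewrite IH.
- by move=> u v w _ IH1 _ IH2 x; rewrite IH1 IH2.
- move=> u v a; apply: (refl_count_insert u [:: a; letter_inv a] v).
    exact: (pe_free _ [::] [::] a).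
  exact: refl_count_free_even.
- move=> u v r [s [t [m_fin ->]]]; apply: refl_count_insert.
    by rewrite mul2n W_relator.
  exact: refl_count_relator_even.
Qed.

Definition is_reduced (l : seq S) : Prop :=
  forall l', pos l' ~ pos l -> size l <= size l'.

Lemma is_reduced_behead {x l} : is_reduced (x :: l) -> is_reduced l.
Proof. by move=> red_xl l' E; apply: (red_xl (x :: l')); rewrite /= E. Qed.

Lemma mem_reflections {l r} : r \in reflections (pos l) ->
  exists P y Q, l = P ++ y :: Q /\ r = conjw (pos P) [:: (y, false)].
Proof.
elim: l r => [|y l IH] r //=.
rewrite in_cons => /orP [/eqP -> | /mapP [r' r'_in ->]].
  by exists [::], y, l.
have [P [y' [Q [-> ->]]]] := IH r' r'_in.
by exists (y :: P), y', Q; rewrite /conjw /= !winv_cons -!catA.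
Qed.

Lemma reduced_head_reflections x l : is_reduced (x :: l) ->
  forall r, r \in reflections (pos l) -> ~ r ~ [:: (x, false)].
Proof.
move=> red_xl r /mem_reflections [P [y [Q [El ->]]]] /(conjw_cat (pos Q)) E.
move: red_xl; rewrite El => red_xl.
(* Deleting y together with the head x gives a shorter word for the same
   element. *)
suff : pos (P ++ Q) ~ pos (x :: P ++ y :: Q).
  by move/red_xl; rewrite /= !size_cat /= addnS ltnNge leqnSn.
rewrite -[x :: _]cat1s -[y :: Q]cat1s !pos_cat.
by rewrite [pos [:: y] ++ _]/= E catA -[pos [:: x] ++ _]/([:: _; _]) W_gen_sq.
Qed.

Lemma refl_count_reduced_head x l :
  is_reduced (x :: l) -> refl_count (pos (x :: l)) [:: (x, false)] = 1.
Proof.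
move=> red_xl; rewrite /refl_count /= count_conjw.
have -> : W_eqb [:: (x, false)] [:: (x, false)] by apply/W_eqbP.
apply/eqP; rewrite eqSS eqn0Ngt -has_count; apply/hasPn => r r_in.
apply/W_eqbP; rewrite catKw; exact: reduced_head_reflections r_in.
Qed.

Lemma reduced_exchange {x l l'} :
  is_reduced (x :: l) -> pos (x :: l) ~ pos l' ->
  exists P y Q,
    l' = P ++ y :: Q /\ conjw (pos P) [:: (y, false)] ~ [:: (x, false)].
Proof.
move=> red_xl E.
have odd_cnt : odd (refl_count (pos l') [:: (x, false)]).
  by rewrite -(refl_count_odd_W_eq E) refl_count_reduced_head.
have /hasP [r r_in /W_eqbP r_x] :
    has (W_eqb^~ [:: (x, false)]) (reflections (pos l')).
  by rewrite has_count; move: odd_cnt; rewrite /refl_count; case: count.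
have [P [y [Q [-> r_eq]]]] := mem_reflections r_in.
by exists P, y, Q; rewrite -r_eq.
Qed.

Local Notation "u ≡ v" := (pres_eq (ad_rel m) u v) (at level 70).
Local Notation gens l := (pos (map (gen_of m) l)).

Lemma conjQ_subproof (x : QW m) v : inQ m (winv v ++ proj1_sig x ++ v).
Proof.
case: x => w [u [s E]] /=; exists (u ++ v), s; rewrite /W_eq in E *.
by rewrite E winv_cat -!catA.
Qed.

Definition conjQ (x : QW m) (v : word S) : QW m :=
  exist _ (winv v ++ proj1_sig x ++ v) (conjQ_subproof x v).

Lemma Ad_gen_congr (x x' : QW m) :
  proj1_sig x ~ proj1_sig x' -> [:: (x, false)] ≡ [:: (x', false)].
Proof. by move=> E; apply: pres_eq_rel_last; left; exists x, x'. Qed.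

Lemma phi_cat a b : phi m (a ++ b) = phi m a ++ phi m b.
Proof. by rewrite /phi map_cat flatten_cat. Qed.

Lemma phi_letter_inv g : phi m [:: letter_inv g] = winv (phi m [:: g]).
Proof. by case: g => y []; rewrite /phi /= ?cats0 ?winvK. Qed.

Lemma phi_winv a : phi m (winv a) = winv (phi m a).
Proof.
elim: a => [|g a IH] //.
by rewrite winv_cons phi_cat IH -[g :: a]cat1s phi_cat winv_cat phi_letter_inv.
Qed.

Lemma Ad_conj_pos (y x : QW m) :
  [:: (y, true); (x, false); (y, false)] ≡
  [:: (conjQ x (proj1_sig y), false)].
Proof.
apply: pres_eq_rel_last; right; exists x, y, (conjQ x (proj1_sig y)).
by rewrite /W_eq /= W_QW_inv.
Qed.

Lemma Ad_conj_neg (y x : QW m) :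
  [:: (y, false); (x, false); (y, true)] ≡
  [:: (conjQ x (winv (proj1_sig y)), false)].
Proof.
set z := conjQ x (winv (proj1_sig y)).
have : conjw (winv [:: (y, false)]) [:: (z, false)] ≡ [:: (x, false)].
  rewrite -[conjw _ _]/[:: (y, true); (z, false); (y, false)] Ad_conj_pos.
  apply: Ad_gen_congr => /=.
  by rewrite winvK -!catA catKw catVw cats0.
by move/conjw_eqE; rewrite winvK => ->.
Qed.

Lemma Ad_conj_letter g (x : QW m) :
  [:: letter_inv g; (x, false); g] ≡ [:: (conjQ x (phi m [:: g]), false)].
Proof.
case: g => y []; rewrite ?Ad_conj_neg ?Ad_conj_pos.
all: by apply: Ad_gen_congr; rewrite /phi /= cats0.
Qed.

Lemma Ad_conj a (x : QW m) :
  winv a ++ [:: (x, false)] ++ a ≡ [:: (conjQ x (phi m a), false)].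
Proof.
elim: a x => [|g a IH] x; first by apply: Ad_gen_congr; rewrite /= cats0.
rewrite winv_cons -catA.
rewrite -[[:: letter_inv g] ++ _]/([:: letter_inv g; (x, false); g] ++ a).
rewrite Ad_conj_letter IH; apply: Ad_gen_congr.
by rewrite /= -[g :: a]cat1s phi_cat winv_cat -!catA.
Qed.

Lemma ker_phi_central c : phi m c ~ [::] -> central (ad_rel m) c.
Proof.
move=> c1.
have c_gen (x : QW m) : c ++ [:: (x, false)] ≡ [:: (x, false)] ++ c.
  transitivity (c ++ winv c ++ [:: (x, false)] ++ c); last by rewrite catKVw.
  rewrite Ad_conj; apply: cat_pres_eq => //.
  by apply: Ad_gen_congr; rewrite /= c1 cats0.
have c_letter g : c ++ [:: g] ≡ [:: g] ++ c.
  by case: g => x []; [exact: (commute_winv (c_gen x)) | exact: c_gen].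
elim=> [|g a IH]; first by rewrite cats0.
by rewrite -[g :: a]cat1s catA c_letter -catA IH.
Qed.

Lemma phi_gens l : phi m (gens l) = pos l.
Proof. by elim: l => //= s l <-. Qed.

Lemma gens_conj_commute {P : seq S} {y x} :
  conjw (pos P) [:: (y, false)] ~ [:: (x, false)] ->
  gens P ++ [:: (gen_of m y, false)] ≡ [:: (gen_of m x, false)] ++ gens P.
Proof.
move=> E; rewrite -[_ ++ [:: _]]cats0 -[[:: _] ++ gens P]cats0 -!catA.
apply: conjw_cat; rewrite /conjw -{1}[gens P]winvK Ad_conj.
by apply: Ad_gen_congr; rewrite /= phi_winv winvK phi_gens.
Qed.

Lemma Ad_eq_reduced l l' :
  is_reduced l -> is_reduced l' -> pos l ~ pos l' -> gens l ≡ gens l'.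
Proof.
elim: l l' => [|x l IH] l' red_l red_l' E.
  have : size l' <= 0 := red_l' [::] E.
  by rewrite leqn0 => /nilP ->.
have [P [y [Q [El' exch]]]] := reduced_exchange red_l E.
have E' : pos l' ~ [:: (x, false)] ++ pos (P ++ Q).
  by rewrite El' !pos_cat; exact: (conjw_cat (pos Q) exch).
have El : pos l ~ pos (P ++ Q).
  by apply: (pres_eq_catlI [:: (x, false)]); rewrite -E' -E.
have red_PQ : is_reduced (P ++ Q).
  move=> l'' E''.
  have : size l' <= size (x :: l'') by apply: red_l'; rewrite E' -E''.
  by rewrite El' !size_cat /= addnS ltnS.
rewrite -[gens (x :: l)]/([:: (gen_of m x, false)] ++ gens l).
rewrite (IH _ (is_reduced_behead red_l) red_PQ El) El' !map_cat !pos_cat.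
by rewrite catA -(gens_conj_commute exch) -catA.
Qed.

Lemma reduced_expr_exists w : exists l, reduced_expr m w l.
Proof.
suff shorten n l : size l <= n -> pos l ~ w -> exists l, reduced_expr m w l.
  exact: (shorten _ _ (leqnn _) (W_pos_fst w)).
elim: n l => [|n IH] l l_n lw.
  by exists l; split=> // l' _; move: l_n; rewrite leqn0 => /eqP ->.
case: (classic (exists l', pos l' ~ w /\ size l' < size l)) => [|min_l].
  move=> [l' [l'w lt_l'l]].
  by apply: (IH l') => //; exact: leq_trans lt_l'l l_n.
exists l; split=> // l' l'w; rewrite leqNgt; apply/negP => lt_l'l.
by apply: min_l; exists l'.
Qed.

Lemma red_of_spec w : reduced_expr m w (red_of m w).
Proof. by rewrite /red_of; apply: epsilon_spec; apply: reduced_expr_exists. Qed.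

Lemma red_of_reduced w : is_reduced (red_of m w).
Proof.
by case: (red_of_spec w) => Ew min_w l' El'; apply: min_w; rewrite /W_eq El'.
Qed.

Lemma Fmap_W_eq {w w'} : w ~ w' -> Fmap m w ≡ Fmap m w'.
Proof.
move=> E; apply: Ad_eq_reduced (red_of_reduced w) (red_of_reduced w') _.
by case: (red_of_spec w) (red_of_spec w') => Ew _ [Ew' _]; rewrite Ew Ew'.
Qed.

Lemma phi_Fmap w : phi m (Fmap m w) ~ w.
Proof. by rewrite /Fmap phi_gens; case: (red_of_spec w). Qed.

Lemma Fmap_nil : Fmap m [::] = [::].
Proof.
case: (red_of_spec [::]) => _ /(_ [::] (pe_refl _ _)).
by rewrite leqn0 /Fmap => /nilP ->.
Qed.

Lemma ccoc_in_C w1 w2 : inC m (ccoc m w1 w2).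
Proof. by rewrite /inC /ccoc !phi_cat phi_winv !phi_Fmap catA catwV. Qed.

Lemma ccoc_central w1 w2 : central (ad_rel m) (ccoc m w1 w2).
Proof. exact/ker_phi_central/ccoc_in_C. Qed.

Lemma ccoc_normalized_2cocycle : normalized_2cocycle m (ccoc m).
Proof.
split; last split; last split.
- move=> w1 w1' w2 w2' E1 E2; rewrite /W_eq in E1 E2.
  have E12 : w1 ++ w2 ~ w1' ++ w2' by rewrite E1 E2.
  by rewrite /Ad_eq /ccoc (Fmap_W_eq E1) (Fmap_W_eq E2) (Fmap_W_eq E12).
- exact: ccoc_in_C.
- by move=> w; rewrite /ccoc Fmap_nil cats0; split; apply: catwV.
- move=> g h k; rewrite /Ad_eq /ccoc -[(g ++ h) ++ k]catA.
  exact: cocycle_identity (ccoc_central h k) (ccoc_central g h).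
Qed.

Lemma ccoc_cohomologous sigma :
  is_section m sigma -> cohomologous m (ccoc m) (ext_cocycle m sigma).
Proof.
move=> [sigma_W_eq phi_sigma].
pose b w := Fmap m w ++ winv (sigma w).
have b_in_C w : inC m (b w).
  by rewrite /inC /b phi_cat phi_winv phi_Fmap -{1}(phi_sigma w) catwV.
have Fmap_b w : Fmap m w ≡ b w ++ sigma w by rewrite /b -catA catVw cats0.
exists b; split; last split => //.
  by move=> w w' E; rewrite /b /Ad_eq (Fmap_W_eq E) (sigma_W_eq _ _ E).
move=> w1 w2; apply: cocycle_coboundary (Fmap_b w1) (Fmap_b w2) (Fmap_b _);
  exact/ker_phi_central/b_in_C.
Qed.

End Coxeter.

Theorem proposition4p3 (S : finType) (m : S -> S -> nat) :
  coxeter_matrix m ->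
  normalized_2cocycle m (ccoc m) /\
  (forall sigma : word S -> word (QW m), is_section m sigma ->
     cohomologous m (ccoc m) (ext_cocycle m sigma)).
Proof.
move=> m_cox; split; first exact: ccoc_normalized_2cocycle.
exact: ccoc_cohomologous.
Qed.
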